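(* Let $G$ be a connected $(P_7, C_4, \text{kite})$-free graph with $\delta(G)\ge \omega(G)+1$. If $G$ has no clique cutset, then there is an integer $\ell\ge 0$ such that $G=K_\ell+H$, where $H$ is the Petersen graph or $F$.
   Context: All graphs are finite and simple. $P_t$ and $C_t$ denote the path and cycle on $t$ vertices; $G$ is $H$-free if it has no induced subgraph isomorphic to $H$. A diamond is the graph obtained from two triangles sharing exactly one edge. A kite is the graph consisting of a diamond together with one further vertex adjacent to exactly one of the two degree-2 vertices of the diamond. A clique cutset of $G$ is a clique $K$ such that $G-K$ has more connected components than $G$. $\delta(G)$ is the minimum degree, $\omega(G)$ the clique number. For graphs $G_1,G_2$, $G_1+G_2$ denotes the join: vertex set $V(G_1)\cup V(G_2)$ (disjoint), edge set $E(G_1)\cup E(G_2)\cup\{uv: u\in V(G_1), v\in V(G_2)\}$; $K_0$ is the empty graph. The graph $F$ is obtained from a $7$-hole $v_1v_2\cdots v_7v_1$ by adding a stable set $\{y_1,y_2,y_3\}$ with $N(y_1)=\{v_1,v_4,v_5\}$, $N(y_2)=\{v_2,v_5,v_6\}$, $N(y_3)=\{v_3,v_6,v_7\}$ and no other edges. *)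

(* Defs.v *)
From mathcomp Require Import all_boot.
Set Implicit Arguments. Unset Strict Implicit. Unset Printing Implicit Defensive.

(* A (finite simple) graph is a symmetric irreflexive relation e : rel T on a finType T. *)

Definition erel (n : nat) (l : seq (nat * nat)) : rel 'I_n :=
  fun i j => ((nat_of_ord i, nat_of_ord j) \in l) || ((nat_of_ord j, nat_of_ord i) \in l).

Definition induced_sub (T U : finType) (e : rel T) (h : rel U) : Prop :=
  exists f : U -> T, injective f /\ forall x y, e (f x) (f y) = h x y.

Definition Hfree (T U : finType) (e : rel T) (h : rel U) : Prop := ~ induced_sub e h.

Definition P7 : rel 'I_7 := erel [:: (0,1); (1,2); (2,3); (3,4); (4,5); (5,6)].
Definition C4 : rel 'I_4 := erel [:: (0,1); (1,2); (2,3); (3,0)].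
(* diamond on {0,1,2,3}: triangles 012 and 123 sharing edge 12;
   degree-2 vertices 0 and 3; kite adds vertex 4 adjacent to 0 only *)
Definition kite : rel 'I_5 :=
  erel [:: (0,1); (0,2); (1,2); (1,3); (2,3); (0,4)].

(* The graph F: 7-hole v1..v7 = 0..6, y1 y2 y3 = 7 8 9 *)
Definition Fgraph : rel 'I_10 :=
  erel [:: (0,1); (1,2); (2,3); (3,4); (4,5); (5,6); (6,0);
              (7,0); (7,3); (7,4);
              (8,1); (8,4); (8,5);
              (9,2); (9,5); (9,6)].

Definition pet_vertex := {A : {set 'I_5} | #|A| == 2}.
Definition petersen : rel pet_vertex :=
  fun A B => [disjoint (val A) & (val B)].

Definition join_rel (l : nat) (U : finType) (h : rel U) : rel ('I_l + U)%type :=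
  fun x y => match x, y with
             | inl i, inl j => i != j
             | inr u, inr v => h u v
             | _, _ => true
             end.

Definition isomorphic (T U : finType) (e : rel T) (h : rel U) : Prop :=
  exists f : T -> U, bijective f /\ forall x y, h (f x) (f y) = e x y.

Definition connected (T : finType) (e : rel T) : Prop :=
  (exists x : T, True) /\ forall x y : T, connect e x y.

Definition clique (T : finType) (e : rel T) (K : {set T}) : bool :=
  [forall x in K, forall y in K, (x != y) ==> e x y].

Definition omega (T : finType) (e : rel T) : nat :=
  \max_(K : {set T} | clique e K) #|K|.

Definition deg (T : finType) (e : rel T) (x : T) : nat := #|[set y | e x y]|.

Definition restr (T : finType) (e : rel T) (S : {set T}) : rel T :=
  fun x y => [&& x \in S, y \in S & e x y].
Definition ncomp (T : finType) (e : rel T) (S : {set T}) : nat :=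
  n_comp (restr e S) [pred x | x \in S].

Definition clique_cutset (T : finType) (e : rel T) (K : {set T}) : Prop :=
  clique e K /\ ncomp e setT < ncomp e (~: K).
Arguments join_rel l {U} h.

(* Main.v *)
Require Import Defs.
From mathcomp Require Import all_boot.
Set Implicit Arguments. Unset Strict Implicit. Unset Printing Implicit Defensive.

(** By [C4]- and kite-freeness, every neighbour of a tip of a diamond sees a
    vertex of its centre.  In the absence of clique cutsets this forces a
    universal vertex as soon as there is a diamond: some maximal clique [M] then
    meets the neighbourhood of every outside vertex at least twice, these traces
    on [M] are pairwise nested or differ by one exchange, and if no vertex of [M]
    lies in all of them, the vertices sharing a minimal trace are cut off by a
    clique.

    Deleting the universal vertices therefore leaves a diamond-free graph in
    which, by the degree condition, no neighbourhood is within one vertex of a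
    clique.  A connected ([P7], [C4], diamond)-free graph with this property is
    the Petersen graph: starting from one vertex, repeatedly adding a neighbour
    that must exist, in all admissible ways, closes off after a few hundred
    partial graphs.  The degree condition rules out the graph [F], in which
    minimum degree and clique number are both 3. *)

(** * Exhaustive search in diamond-free graphs *)

(* Unlike [has], short-circuits under the call-by-value [vm_compute]. *)
Fixpoint lhas (A : Type) (f : A -> bool) (s : seq A) : bool :=
  if s is x :: s' then if f x then true else lhas f s' else false.

Lemma lhasE (A : Type) (f : A -> bool) s : lhas f s = has f s.
Proof. by elim: s => //= x s ->; case: (f x). Qed.

(** * Adjacency matrices and the search for induced copies *)

Definition amx (T : Type) (h : rel T) (s : seq T) : seq (seq bool) :=
  [seq [seq h x y | y <- s] | x <- s].

Fixpoint zcons (r : seq bool) (m : seq (seq bool)) : seq (seq bool) :=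
  match r, m with
  | b :: r', s :: m' => (b :: s) :: zcons r' m'
  | _, _ => [::]
  end.

Definition add_row (r : seq bool) (m : seq (seq bool)) : seq (seq bool) :=
  (false :: r) :: zcons r m.

Lemma amx_cons (T : Type) (h : rel T) (w : T) (s : seq T) :
  symmetric h -> irreflexive h ->
  amx h (w :: s) = add_row [seq h w x | x <- s] (amx h s).
Proof.
move=> hsym hirr; rewrite /amx /add_row /= hirr; congr cons.
have: forall t, [seq h x w :: [seq h x y | y <- s] | x <- t] =
   zcons [seq h w x | x <- t] [seq [seq h x y | y <- s] | x <- t]; last exact.
by elim=> //= x t ->; rewrite hsym.
Qed.

(** The part of the adjacency matrix strictly above the diagonal. For a symmetric irreflexive
    relation it determines the graph on the list, and a vertex put in front adds one row. *)
Fixpoint code (T : Type) (h : rel T) (l : seq T) : seq (seq bool) :=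
  if l is a :: l' then [seq h a b | b <- l'] :: code h l' else [::].

Lemma size_code (T : Type) (h : rel T) l : size (code h l) = size l.
Proof. by elim: l => //= a l ->. Qed.

Lemma code_eq (T U : Type) (e : rel T) (h : rel U) t l x0 y0 i j :
  symmetric e -> irreflexive e -> symmetric h -> irreflexive h ->
  code e t = code h l -> i < size t -> j < size t ->
  e (nth x0 t i) (nth x0 t j) = h (nth y0 l i) (nth y0 l j).
Proof.
move=> esym eirr hsym hirr; elim: t l i j => [|x t IH] [|y l] i j //= [Hr Hc].
have Hs : size t = size l by rewrite -(size_code e) Hc size_code.
have Hx k : k < size t -> e x (nth x0 t k) = h y (nth y0 l k).
  by move=> lk; rewrite -(nth_map _ false) // Hr (nth_map y0) // -Hs.
case: i j => [|i] [|j] //=; rewrite ?ltnS => Hi Hj.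
- by rewrite eirr hirr.
- exact: Hx.
- by rewrite esym hsym; exact: Hx.
- exact: IH.
Qed.

(** Nested conditionals in place of [&&] let call-by-value evaluation stop at the first mismatch. *)
Fixpoint agree (row : seq bool) (p : seq nat) (r : seq bool) : bool :=
  match p, r with
  | j :: p', b :: r' => if nth false row j == b then agree row p' r' else false
  | [::], [::] => true
  | _, _ => false
  end.

Lemma agreeP row p r : agree row p r -> [seq nth false row j | j <- p] = r.
Proof.
elim: p r => [|j p IH] [|b r] //=.
by case: eqP => // -> /IH ->.
Qed.

(** Backtracking search for an induced copy: [p] lists the positions already used, latest first, and
    each row prescribes both the edges and the non-edges from the next vertex to them. *)
Fixpoint emb (m rows : seq (seq bool)) (p : seq nat) : bool :=
  if rows is r :: rows' then
    lhas (fun i => if agree (nth [::] m i) p r then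
                     if i \in p then false else emb m rows' (i :: p)
                   else false) (iota 0 (size m))
  else true.

(* Labels are listed with the most recently embedded vertex first; the last
   label is matched to an already known vertex, hence its row is dropped. *)
Definition obs (U : Type) (h : rel U) (l : seq U) : seq (seq bool) :=
  behead (rev (code h l)).

Section Emb.
Variables (T : eqType) (e : rel T).
Hypotheses (esym : symmetric e) (eirr : irreflexive e).

(** Placed vertices go to the front of [p], so the rows, consumed in order, reappear reversed at the
    head of the code. *)
Lemma embP (s : seq T) x0 rows p :
  uniq p -> all (fun i => i < size s) p -> emb (amx e s) rows p ->
  exists q, [/\ uniq (q ++ p), all (fun i => i < size s) (q ++ p) &
    code e [seq nth x0 s i | i <- q ++ p] =
    rev rows ++ code e [seq nth x0 s i | i <- p]].
Proof.
elim: rows p => [|r rows IH] p Up Ap /=; first by exists [::].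
rewrite lhasE => /hasP[i]; rewrite mem_iota add0n size_map => /andP[_ Hi].
case: ifP => // /agreeP Hr; case: ifP => // Hip Hemb.
have [||q [Uq Aq Eq]] := IH (i :: p) _ _ Hemb; rewrite /= ?Hip ?Hi //.
exists (rcons q i); rewrite cat_rcons; split=> //.
rewrite Eq /= rev_cons cat_rcons; congr (_ ++ _ :: _).
rewrite -Hr -map_comp; apply/eq_in_map => j /(allP Ap) Hj /=.
by rewrite (nth_map x0) // (nth_map x0).
Qed.

(** The row dropped by [obs] is that of the last label, which is always empty. *)
Lemma rev_obs (U : Type) (h : rel U) (l : seq U) :
  0 < size l -> rev (obs h l) ++ [:: [::]] = code h l.
Proof.
have [c Hc] : exists c, 0 < size l -> code h l = rcons c [::].
  elim: l => [|a [|b l] [c Hc]]; [by exists [::]| by exists [::] |].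
  by exists ([seq h a b | b <- b :: l] :: c) => _; rewrite rcons_cons -Hc.
by rewrite /obs => /Hc ->; rewrite rev_rcons /= revK cats1.
Qed.

Lemma embedding_rel (U : eqType) (h : rel U) (l : seq U) (t : seq T) (x0 : T) :
  symmetric h -> irreflexive h -> code e t = code h l -> uniq l -> uniq t ->
  forall u v, u \in l -> v \in l ->
    e (nth x0 t (index u l)) (nth x0 t (index v l)) = h u v /\
    (nth x0 t (index u l) = nth x0 t (index v l) -> u = v).
Proof.
move=> hsym hirr Hc Ul Ut u v Hu Hv.
have Hs : size t = size l by rewrite -(size_code e) Hc size_code.
split.
  rewrite (code_eq x0 u esym eirr hsym hirr Hc) ?Hs ?index_mem //.
  by rewrite !nth_index.
move/eqP; rewrite nth_uniq ?Hs ?index_mem // => /eqP E.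
by rewrite -(nth_index u Hu) E nth_index.
Qed.

(** The initial list [[:: 0]] pins the last label of [l] to the new vertex [w]. A successful search
    would be an induced copy, read off through the index of each label in [l]. *)
Lemma obs_free n E (l : seq nat) w (s : seq T) :
  (forall f : 'I_n -> T,
     ~ (injective f /\ forall x y, e (f x) (f y) = erel E x y)) ->
  irreflexive (fun i j => ((i, j) \in E) || ((j, i) \in E)) ->
  perm_eq l (iota 0 n) -> uniq (w :: s) -> 0 < n ->
  ~~ emb (amx e (w :: s))
         (obs (fun i j => ((i, j) \in E) || ((j, i) \in E)) l) [:: 0].
Proof.
move=> Hf hirr Hl Us n0; apply/negP; set h := fun i j => _ => Hemb.
have hsym : symmetric h by move=> i j; rewrite /h orbC.
have [||q [Uq Aq]] := embP w _ _ Hemb => //.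
set p := q ++ [:: 0] in Uq Aq *.
rewrite rev_obs; last by rewrite (perm_size Hl) size_iota.
set t := [seq _ | i <- p] => Hc.
have Ul : uniq l by rewrite (perm_uniq Hl) iota_uniq.
have Ut : uniq t.
  rewrite map_inj_in_uniq // => i j Hi Hj /eqP.
  by rewrite nth_uniq ?(allP Aq) // => /eqP.
have Hin (i : 'I_n) : (i : nat) \in l.
  by rewrite (perm_mem Hl) mem_iota add0n /=.
apply: (Hf (fun i => nth w t (index (i : nat) l))); split=> i j.
  by have [_ H] := embedding_rel w hsym hirr Hc Ul Ut (Hin i) (Hin j) => /H/val_inj.
by have [H _] := embedding_rel w hsym hirr Hc Ul Ut (Hin i) (Hin j).
Qed.
End Emb.

(** * Forbidden subgraphs and the search tree *)

Definition edges (E : seq (nat * nat)) : rel nat :=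
  fun i j => ((i, j) \in E) || ((j, i) \in E).

Definition P7_edges := [:: (0,1); (1,2); (2,3); (3,4); (4,5); (5,6)].
Definition C4_edges := [:: (0,1); (1,2); (2,3); (3,0)].
Definition diamond_edges := [:: (0,1); (0,2); (1,2); (1,3); (2,3)].

(* A forbidden subgraph created by a new vertex contains it, so one labelling
   suffices for each orbit of the pinned vertex. *)
Definition P7_obs := Eval vm_compute in
  [seq obs (edges P7_edges) (rev l) | l <-
    [:: [:: 0; 1; 2; 3; 4; 5; 6]; [:: 1; 0; 2; 3; 4; 5; 6];
        [:: 2; 3; 1; 0; 4; 5; 6]; [:: 3; 4; 2; 5; 1; 6; 0]]].
Definition C4_obs := Eval vm_compute in
  [seq obs (edges C4_edges) (rev l) | l <- [:: [:: 0; 1; 2; 3]]].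
Definition diamond_obs := Eval vm_compute in
  [seq obs (edges diamond_edges) (rev l) | l <-
    [:: [:: 0; 1; 2; 3]; [:: 1; 2; 0; 3]]].

Definition bad (m : seq (seq bool)) : bool :=
  lhas (lhas (fun o => emb m o [:: 0])) [:: C4_obs; diamond_obs; P7_obs].

Definition extend (m V : seq (seq bool)) : seq (seq bool) :=
  [seq r <- [seq false :: r | r <- V] ++ [seq true :: r | r <- V]
    | ~~ bad (add_row r m)].

Definition nbrs (m : seq (seq bool)) (i : nat) : seq nat :=
  [seq j <- iota 0 (size m) | nth false (nth [::] m i) j].

Definition is_clique (m : seq (seq bool)) (Q : seq nat) : bool :=
  all (fun i => all (fun j => (i == j) || nth false (nth [::] m i) j) Q) Q.

(* A pair [(i, Q)] records that vertex [i] has a neighbour outside the partial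
   graph which, unless [Q] is empty, is not complete to the clique [Q]. *)
Definition demand (m : seq (seq bool)) (i : nat) : seq (nat * seq nat) :=
  let N := nbrs m i in
  if nilp N then [:: (i, [::])] else
  [seq (i, Q) | Q <- take 1
    [seq Q <- [seq [seq c <- N | (b == c) || nth false (nth [::] m b) c] | b <- N]
      | (size N <= (size Q).+1) && is_clique m Q]].

Definition sel (r : seq bool) (d : nat * seq nat) : bool :=
  nth false r d.1 && (nilp d.2 || ~~ all (nth false r) d.2).

Fixpoint shortest (A : Type) (c : seq A) (cs : seq (seq A)) : seq A :=
  if cs is c' :: cs' then shortest (if size c' < size c then c' else c) cs' else c.

Lemma shortest_mem (A : eqType) (c : seq A) cs : shortest c cs \in c :: cs.
Proof.
elim: cs c => [|c' cs IH] c /=; first by rewrite mem_head.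
have := IH (if size c' < size c then c' else c).
by case: ifP; rewrite !inE => _ /orP[->|->]; rewrite ?orbT.
Qed.

(** The two-element subsets of a five-element set as ordered pairs; [pet_lrel] is disjointness in a
    form that computes. The search for this graph pins no vertex, so [petersen_obs] keeps every
    row. *)
Definition pet_label :=
  [:: (0,1); (0,2); (0,3); (0,4); (1,2); (1,3); (1,4); (2,3); (2,4); (3,4)].

Definition pet_lrel : rel (nat * nat) :=
  fun a b => [&& a.1 != b.1, a.1 != b.2, a.2 != b.1 & a.2 != b.2].
Definition petersen_obs := Eval vm_compute in rev (code pet_lrel pet_label).

Definition is_petersen (m : seq (seq bool)) : bool :=
  (size m == 10) && emb m petersen_obs [::].

(* [m] is the adjacency matrix of the partial graph and [V] lists the possible
   adjacency rows of the vertices outside it.  Branching is on the demand that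
   can be met in the fewest ways; without any demand, the partial graph is the
   Petersen graph and every proper extension must still be refuted. *)
Fixpoint solve (k : nat) (m V : seq (seq bool)) : bool :=
  if k is k'.+1 then
    let next r := let m' := add_row r m in solve k' m' (extend m' V) in
    if [seq [seq r <- V | sel r d]
         | d <- flatten [seq demand m i | i <- iota 0 (size m)]]
      is c :: cs then all next (shortest c cs)
    else is_petersen m && all next [seq r <- V | has id r]
  else false.

(** * Correctness of the search *)

Section Solve.
Variables (T : finType) (e : rel T).
Hypotheses (esym : symmetric e) (eirr : irreflexive e).
Hypotheses (hP7 : Hfree e P7) (hC4 : Hfree e C4).
Hypothesis diamond_free : forall a b c d,
  e b c -> e a b -> e a c -> e d b -> e d c -> a != d -> e a d.
Hypothesis nbr_spread : forall x (Q : {set T}), clique e Q -> Q \subset e x ->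
  1 < #|[set y | e x y] :\: Q|.
Hypothesis conn : forall (A : {set T}) x y, x \in A -> y \notin A ->
  exists u w, [/\ u \in A, w \notin A & e u w].

Lemma no_bad w s : uniq (w :: s) -> ~~ bad (amx e (w :: s)).
Proof.
move=> Us; rewrite /bad lhasE; apply/hasPn => O; rewrite lhasE => HO.
have irrE E : all (fun p => p.1 != p.2) E -> irreflexive (edges E).
  by move=> /allP HE i; rewrite /edges orbb; apply/negP => /HE; rewrite eqxx.
apply/hasPn => o Ho; rewrite !inE in HO.
have hD (f : 'I_4 -> T) :
    ~ (injective f /\ forall x y, e (f x) (f y) = erel diamond_edges x y).
  move=> [finj fe].
  have := @diamond_free (f (inord 0)) (f (inord 1)) (f (inord 2)) (f (inord 3)).
  rewrite !fe /erel !inordK // inj_eq // -val_eqE /= !inordK //=.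
  by move/(_ isT isT isT isT isT isT).
case/or3P: HO => /eqP EO; rewrite {}EO in Ho.
(* The obstruction lists are stored in evaluated form; conversion recovers the labellings that
   produced them. *)
- have: o \in [seq obs (edges C4_edges) (rev l) | l <- [:: [:: 0; 1; 2; 3]]] by [].
  case/mapP => l Hl ->; apply: (@obs_free _ _ esym eirr 4) => //.
  + by move=> f Hf; apply: hC4; exists f.
  + exact: (irrE C4_edges).
  + by move: l Hl; apply/allP.
- have: o \in [seq obs (edges diamond_edges) (rev l) | l <-
    [:: [:: 0; 1; 2; 3]; [:: 1; 2; 0; 3]]] by [].
  case/mapP => l Hl ->; apply: (@obs_free _ _ esym eirr 4) => //.
  + exact: (irrE diamond_edges).
  + by move: l Hl; apply/allP.
- have: o \in [seq obs (edges P7_edges) (rev l) | l <-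
    [:: [:: 0; 1; 2; 3; 4; 5; 6]; [:: 1; 0; 2; 3; 4; 5; 6];
        [:: 2; 3; 1; 0; 4; 5; 6]; [:: 3; 4; 2; 5; 1; 6; 0]]] by [].
  case/mapP => l Hl ->; apply: (@obs_free _ _ esym eirr 7) => //.
  + by move=> f Hf; apply: hP7; exists f.
  + exact: (irrE P7_edges).
  + by move: l Hl; apply/allP.
Qed.

Definition rows_in (s : seq T) (V : seq (seq bool)) :=
  forall w, w \notin s -> [seq e w x | x <- s] \in V.

(** Any further vertex spans with [w :: s] a graph without obstructions, so its row survives the
    filter. *)
Lemma extend_rows w s V : uniq (w :: s) -> rows_in s V ->
  rows_in (w :: s) (extend (amx e (w :: s)) V).
Proof.
move=> Us HV u Hu; rewrite mem_filter -amx_cons // no_bad ?cons_uniq ?Hu //=.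
have {}HV : [seq e u x | x <- s] \in V.
  by apply: HV; apply: contra Hu; rewrite inE orbC => ->.
by rewrite mem_cat; case: (e u w); rewrite map_f ?orbT.
Qed.

(** If every outside neighbour of [x] were complete to [Q], diamond-freeness would make these
    neighbours and [Q] together a clique in the neighbourhood of [x]. At most one neighbour of [x]
    would be missing from it, contrary to [nbr_spread]. *)
Lemma demandP s i d : uniq s -> i < size s -> d \in demand (amx e s) i ->
  exists2 w, w \notin s & sel [seq e w x | x <- s] d.
Proof.
move=> Us Hi.
have [x0 _] : exists x : T, True by case: s Hi {Us} => // x; exists x.
set m := amx e s; set x := nth x0 s i.
have ent j k : j < size s -> k < size s ->
    nth false (nth [::] m j) k = e (nth x0 s j) (nth x0 s k).
  by move=> Hj Hk; rewrite (nth_map x0) // (nth_map x0).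
have mN j : (j \in nbrs m i) = (j < size s) && e x (nth x0 s j).
  rewrite mem_filter mem_iota add0n size_map andbC /=.
  by case: (ltnP j (size s)) => //= Hj; rewrite ent.
have old y : e x y -> y \in s -> index y s \in nbrs m i.
  by move=> Hxy Hy; rewrite mN index_mem Hy nth_index.
rewrite /demand; case: nilP => [N0|_].
  rewrite inE => /eqP ->.
  have /card_gt1P[y [z []]] : 1 < #|[set y | e x y] :\: set0|.
    apply: nbr_spread; last by apply/subsetP => y; rewrite inE.
    by apply/forall_inP => y; rewrite inE.
  rewrite !inE /= => Hxy _ _; exists y.
    by apply/negP => /(old y Hxy); rewrite N0.
  by rewrite /sel /= andbT (nth_map x0) // esym.
case/mapP => Q /mem_take; rewrite mem_filter => /andP[/andP[HN HQ]].
case/mapP => b Hb EQ ->.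
have bQ : b \in Q by rewrite EQ mem_filter eqxx.
have QN j : j \in Q -> (j < size s) && e x (nth x0 s j).
  by rewrite EQ mem_filter => /andP[_]; rewrite mN.
case: (boolP [exists w, (w \notin s) && sel [seq e w x | x <- s] (i, Q)]).
  by case/existsP => w /andP[Hw Hs]; exists w.
rewrite negb_exists => /forallP Hno; exfalso.
have new w : w \notin s -> e x w -> forall j, j \in Q -> e w (nth x0 s j).
  move=> Hw Hxw j Hj; have := Hno w; rewrite Hw /= /sel /= (nth_map x0) //.
  rewrite esym Hxw negb_or negbK => /andP[_ /allP/(_ j Hj)].
  by rewrite (nth_map x0) //; case/andP: (QN j Hj).
pose K := [set y in [seq nth x0 s j | j <- Q]] :|: [set w | (w \notin s) && e x w].
have KN : K \subset e x.
  apply/subsetP => y; rewrite !inE => /orP[/mapP[j /QN/andP[_ H] ->]//|/andP[_ H]].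
  exact: H.
have Kcl : clique e K.
  have QK j k : j \in Q -> k \in Q -> nth x0 s j != nth x0 s k ->
      e (nth x0 s j) (nth x0 s k).
    move=> Hj Hk Hjk; have /andP[lj _] := QN j Hj; have /andP[lk _] := QN k Hk.
    have := allP (allP HQ j Hj) k Hk; rewrite ent //.
    by case/orP=> // /eqP jk; move: Hjk; rewrite jk eqxx.
  apply/forall_inP => y Hy; apply/forall_inP => z Hz; apply/implyP => Hyz.
  move: Hy Hz; rewrite !inE.
  case/orP=> [/mapP[j Hj Ey]|/andP[Hy xy]]; case/orP=> [/mapP[k Hk Ez]|/andP[Hz xz]].
  + by move: Hyz; rewrite Ey Ez; exact: QK.
  + by rewrite esym Ey; exact: new.
  + by rewrite Ez; exact: new.
  + have /andP[_ xb] := QN b bQ.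
    by apply: (diamond_free xb) => //; rewrite ?[e _ x]esym //; exact: new.
have /card_gt1P[y [z []]] := nbr_spread Kcl KN.
rewrite !inE !negb_or !negb_and !negbK.
case/andP=> /andP[yQ ys] xy /andP[/andP[zQ zs] xz] yz.
have ys' : y \in s by move: ys xy => /orP[//|/negP].
have zs' : z \in s by move: zs xz => /orP[//|/negP].
have idxQ u : u \in s -> u \notin [seq nth x0 s j | j <- Q] -> index u s \notin Q.
  move=> us; apply: contra => uQ; apply/mapP; exists (index u s) => //.
  by rewrite nth_index.
(* The two neighbours of [x] outside [K] are old vertices whose positions are not in [Q], so
   [nbrs m i] has at least two elements more than [Q]. *)
have /uniq_leq_size : uniq [:: index y s, index z s & Q].
  rewrite /= inE negb_or idxQ // idxQ // andbT; apply/andP; split.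
    by apply: contra yz => /eqP E; rewrite -(nth_index x0 ys') E nth_index.
  by rewrite EQ !filter_uniq ?iota_uniq.
move/(_ (nbrs m i)); rewrite /= => H; have: (size Q).+2 <= size (nbrs m i).
  apply: H => j; rewrite !inE => /or3P[/eqP->|/eqP->|/QN]; rewrite ?old //.
  by rewrite mN.
by rewrite ltnNge HN.
Qed.

Lemma card_pet : #|{: pet_vertex}| = 10.
Proof.
rewrite card_sig -(eq_card (A := [set A : {set 'I_5} | #|A| == 2])); last first.
  by move=> A; rewrite !inE.
by rewrite card_draws card_ord.
Qed.

Lemma is_petersenP s : uniq s -> (forall x, x \in s) -> is_petersen (amx e s) ->
  isomorphic e petersen.
Proof.
move=> Us Hs /andP[/eqP]; rewrite size_map => s10.
have [x0 _] : exists x : T, True by case: s s10 {Us Hs} => // x; exists x.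
case/(embP x0) => // p [Up Ap]; rewrite cats0 in Up Ap *; rewrite cats0.
set t := [seq _ | i <- p] => Hc.
have {}Hc : code e t = code pet_lrel pet_label by rewrite Hc.
have Ut : uniq t.
  rewrite map_inj_in_uniq // => i j Hi Hj /eqP.
  by rewrite nth_uniq ?(allP Ap) // => /eqP.
have t10 : size t = 10 by rewrite -(size_code e) Hc.
have szt : size t = size pet_label by rewrite t10.
have t_all x : x \in t.
  have [|_ -> //] := @uniq_min_size _ t s Ut (fun y _ => Hs y).
  by rewrite s10 t10.
(* An arbitrary default that makes [pv] total; on the labels themselves [pv] is the actual
   two-element set. *)
have dflt : #|[set (inord 0 : 'I_5); inord 1]| == 2.
  by rewrite cards2 -val_eqE /= !inordK.
pose pv (a : nat * nat) : pet_vertex :=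
  insubd (exist (fun A : {set 'I_5} => #|A| == 2) _ dflt) [set inord a.1; inord a.2].
pose lab x := nth (0, 0) pet_label (index x t).
have lab_in x : lab x \in pet_label by rewrite mem_nth // -szt index_mem.
have edge x y : e x y = pet_lrel (lab x) (lab y).
  rewrite -{1}(nth_index x0 (t_all x)) -{1}(nth_index x0 (t_all y)).
  apply: code_eq => //; rewrite ?index_mem //.
  - move=> [a b] [c d]; rewrite /pet_lrel /=.
    rewrite ![c == _]eq_sym ![d == _]eq_sym.
    by case: (a == c); case: (a == d); case: (b == c); case: (b == d).
  - by move=> [a b]; rewrite /pet_lrel /= eqxx.
have pvE : {in pet_label &, forall a b, petersen (pv a) (pv b) = pet_lrel a b}.
  have small : {in pet_label, forall a, [&& a.1 < 5, a.2 < 5 & a.1 != a.2]}.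
    exact/allP.
  have valE a : a \in pet_label -> val (pv a) = [set inord a.1; inord a.2].
    case/small/and3P => a1 a2 a12; rewrite val_insubd cards2.
    by rewrite -val_eqE /= !inordK // a12.
  have ineq (i j : nat) : i < 5 -> j < 5 ->
      ((inord i : 'I_5) == inord j) = (i == j).
    by move=> Hi Hj; rewrite -val_eqE /= !inordK.
  move=> a b Ha Hb; rewrite /petersen !valE //.
  have /and3P[a1 a2 _] := small a Ha; have /and3P[b1 b2 _] := small b Hb.
  rewrite /pet_lrel disjoints_subset subUset !sub1set !inE !ineq // !negb_or.
  by rewrite -!andbA.
(* No neighbourhood in the Petersen graph is contained in another, so labels with the same image
   under [pv] are equal. *)
have twin_free : {in pet_label &, forall a b, a != b ->
    has (fun c => pet_lrel a c && ~~ pet_lrel b c) pet_label}.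
  move=> a b Ha Hb; apply/implyP.
  by move: b Hb; apply/allP; move: a Ha; apply/allP.
have lab_inj : injective lab.
  move=> x y /eqP; rewrite nth_uniq -?szt ?index_mem //.
  by move=> /eqP E; rewrite -(nth_index x0 (t_all x)) E nth_index.
exists (fun x => pv (lab x)); split; last by move=> x y /=; rewrite pvE ?edge.
apply: inj_card_bij; last by rewrite card_pet -t10 -(card_uniqP Ut) max_card.
move=> x y /= Exy; apply: lab_inj; apply/eqP/negP => /negP/twin_free.
case/(_ (lab_in x) (lab_in y))/hasP=> c Hc' /andP[].
by rewrite -!pvE // Exy => ->.
Qed.

(** Some actual vertex meets the chosen demand and its row is in [V], so one of the branches
    describes the graph; an empty list of branches is a contradiction. *)
Lemma solveP k s V : s != [::] -> uniq s -> rows_in s V ->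
  solve k (amx e s) V -> isomorphic e petersen.
Proof.
elim: k s V => //= k IH s V sN0 Us HV.
have step w : w \notin s ->
    solve k (add_row [seq e w x | x <- s] (amx e s))
      (extend (add_row [seq e w x | x <- s] (amx e s)) V) ->
    isomorphic e petersen.
  move=> Hw; rewrite -amx_cons // => /IH; apply => //; first by rewrite /= Hw.
  by apply: extend_rows => //=; rewrite Hw.
case E: [seq _ | d <- _] => [|c cs].
  case/andP=> Hpet /allP Hnext.
  case: (boolP [forall x, x \in s]) => [/forallP Hs|].
    exact: is_petersenP Hpet.
  rewrite negb_forall => /existsP[y Hy].
  have [z Hz] : exists z, z \in s.
    by case: s sN0 {E HV Us Hpet Hnext Hy step} => // z s; exists z; rewrite mem_head.
  (* Connectivity gives an outside vertex with a neighbour in [s]; its row is nonzero, hence among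
     the extensions that were checked. *)
  have [||u [w []]] := conn (A := [set x in s]) (x := z) (y := y); rewrite ?inE //.
  move=> us ws uw; apply: (step w ws); apply: Hnext.
  rewrite mem_filter HV // andbT; apply/hasP; exists (e w u); rewrite ?map_f //.
  by rewrite /= esym.
move/allP=> Hnext; have := shortest_mem c cs; rewrite -E.
case/mapP => d /flatten_mapP[i]; rewrite mem_iota add0n size_map.
move=> /andP[_ Hi] Hd Ec.
have [w Hw Hsel] := demandP Us Hi Hd.
by apply: (step w Hw); apply: Hnext; rewrite Ec mem_filter Hsel HV.
Qed.
End Solve.

(** The start is a single vertex, to which any other vertex is adjacent or not. With fuel 14,
    partial graphs of up to 14 vertices are examined, and every branch closes by then. *)
Lemma solve_check : solve 14 [:: [:: false]] [:: [:: false]; [:: true]].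
Proof. by vm_compute. Qed.

Lemma isomorphic_petersen (T : finType) (e : rel T) :
  symmetric e -> irreflexive e -> Hfree e P7 -> Hfree e C4 ->
  (forall a b c d, e b c -> e a b -> e a c -> e d b -> e d c -> a != d -> e a d) ->
  (forall x (Q : {set T}), clique e Q -> Q \subset e x ->
     1 < #|[set y | e x y] :\: Q|) ->
  (forall (A : {set T}) x y, x \in A -> y \notin A ->
     exists u w, [/\ u \in A, w \notin A & e u w]) ->
  T -> isomorphic e petersen.
Proof.
move=> esym eirr hP7 hC4 hD hN hconn x.
apply: (solveP esym eirr hP7 hC4 hD hN hconn (s := [:: x])) => //=.
  2: rewrite /amx /= eirr; exact: solve_check.
by move=> w _; rewrite /=; case: (e w x); rewrite !inE ?orbT.
Qed.

(** * Diamonds and universal vertices *)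

Lemma connect_boundary (T : finType) (r : rel T) (A : {set T}) x y :
  connect r x y -> x \in A -> y \notin A ->
  exists u w, [/\ u \in A, w \notin A & r u w].
Proof.
case/connectP=> p; elim: p x => [|z p IH] x /=; first by move=> _ -> ->.
case/andP=> rxz Hp Hy Hx HyA; case: (boolP (z \in A)) => Hz; first exact: (IH z).
by exists x, z.
Qed.

Section Diamond.
Variables (T : finType) (e : rel T).
Hypotheses (esym : symmetric e) (eirr : irreflexive e).
Hypothesis C4_free : forall a b c d,
  e a b -> e b c -> e c d -> e d a -> ~~ e a c -> a != c -> b != d -> e b d.
(* In a (C4, kite)-free graph, a neighbour of a tip of a diamond sees its centre. *)
Hypothesis kite_free : forall a b c d x,
  e b c -> e a b -> e a c -> e d b -> e d c -> a != d -> ~~ e a d ->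
  e x a -> x != b -> x != c -> e x b || e x c.
(** Absence of clique cutsets as an edge leaving [C] in the graph without [K]; for empty [K] this is
    connectedness. *)
Hypothesis no_cut : forall (K C : {set T}) x y, clique e K -> [disjoint C & K] ->
  x \in C -> y \notin C -> y \notin K ->
  exists u w, [/\ u \in C, w \notin C, w \notin K & e u w].
Hypothesis no_universal : forall x, exists2 y, y != x & ~~ e x y.

Lemma cliqueP (K : {set T}) :
  reflect {in K &, forall x y, x != y -> e x y} (clique e K).
Proof.
apply: (iffP forall_inP) => [H x y Hx Hy|H x Hx].
  by move: (forall_inP (H x Hx) y Hy) => /implyP.
by apply/forall_inP => y Hy; apply/implyP; exact: H.
Qed.

Lemma edge_neq x y : e x y -> x != y.
Proof. by apply: contraTneq => ->; rewrite eirr. Qed.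

(** The neighbourhood of a vertex [q] in the centre of a diamond induces a connected graph. With [H]
    the component of the tip [a] there, a clique cutset argument yields a vertex [v] outside the
    neighbourhood of [q] that is, like [q], a tip of a diamond with centre in [H]; then every
    neighbour of [q] sees [H]. *)
Lemma centre_nbrs_connected q c a d :
  e q c -> e a q -> e a c -> e d q -> e d c -> a != d -> ~~ e a d ->
  forall (Z : {set T}) x y, Z \subset e q -> x \in Z -> e q y -> y \notin Z ->
    exists u w, [/\ u \in Z, w \notin Z, e q w & e u w].
Proof.
move=> qc aq ac dq dc ad nad.
pose r := restr e [set x | e q x].
have rsym : symmetric r.
  by move=> x y; rewrite /r /restr [e x y]esym andbCA.
have rE x y : r x y = [&& e q x, e q y & e x y] by rewrite /r /restr !inE.
pose H := [set x | connect r a x].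
have HE x : (x \in H) = connect r a x by rewrite inE.
clearbody H.
have Hq x : x \in H -> e q x.
  rewrite HE => ax; apply/negPn/negP => nqx.
  have [||u [w [_]]] := connect_boundary (A := [set z | e q z]) ax.
  - by rewrite inE esym.
  - by rewrite inE.
  by rewrite inE rE => /negP nw /and3P[_ /nw].
have aH : a \in H by rewrite HE.
have stepH u w : u \in H -> e q w -> e u w -> w \in H.
  move=> Hu qw uw; have qu := Hq u Hu; move: Hu; rewrite !HE => au.
  by apply: connect_trans au _; apply: connect1; rewrite rE qu qw uw.
have cH : c \in H by apply: (stepH a).
have dH : d \in H by apply: (stepH c) => //; rewrite esym.
(* The vertices of [H] that have a non-neighbour in [H]; the rest of [H] together with [q] is a
   clique, which therefore does not separate [C] from [y]. *)
pose C := [set u in H | [exists x in H, (x != u) && ~~ e u x]].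
have CE u : (u \in C) = (u \in H) && [exists x in H, (x != u) && ~~ e u x].
  by rewrite in_set.
have HC u : u \in H -> u \notin C -> forall x, x \in H -> x != u -> e u x.
  move=> uH; rewrite CE uH /= negb_exists_in => /forall_inP Hu x Hx xu.
  by have := Hu x Hx; rewrite xu negbK.
have [y yq nqy] := no_universal q.
have yH : y \notin H by apply: contra nqy; exact: Hq.
have CH u : u \in C -> u \in H by rewrite CE => /andP[].
have [|||||h [v [hC vC vK hv]]] := @no_cut (q |: (H :\: C)) C a y.
- apply/cliqueP => u w; rewrite !in_setU1 !in_setD.
  case/predU1P=> [->|/andP[uC uH]]; case/predU1P=> [->|/andP[wC wH]] uw.
  + by rewrite eqxx in uw.
  + exact: Hq.
  + by rewrite esym; exact: Hq.
  + by apply: HC; rewrite // eq_sym.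
- rewrite disjoints_subset; apply/subsetP => u uC.
  rewrite in_setC in_setU1 in_setD uC orbF eq_sym.
  exact: edge_neq (Hq _ (CH _ uC)).
- by rewrite CE aH; apply/exists_inP; exists d => //; rewrite eq_sym ad.
- by apply: contra yH; exact: CH.
- by rewrite in_setU1 in_setD (negbTE yq) (negbTE yH) andbF.
have vH : v \notin H.
  by apply: contra vK => vH; rewrite in_setU1 in_setD vC vH orbT.
have vq : v != q by apply: contra vK => /eqP ->; rewrite setU11.
have hH := CH _ hC.
have nvq : ~~ e v q.
  by apply: contra vH => Hvq; apply: (stepH h) => //; rewrite esym.
have [z zH /andP[zh nhz]] : exists2 x, x \in H & (x != h) && ~~ e h x.
  by move: hC; rewrite CE => /andP[_ /exists_inP[x]]; exists x.
(* A path in [H] from [h] to its non-neighbour [z] must leave the closed neighbourhood of [h]; [h']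
   and [h''] are the ends of that step. *)
have [h' [h'' [h'H nh'' hh' qh'' h'h'']]] :
    exists h' h'', [/\ h' \in H, h'' != h /\ ~~ e h h'', e h h', e q h'' & e h' h''].
  have hz : connect r h z.
    move: hH zH; rewrite !HE => ah; apply: connect_trans.
    by rewrite (sym_connect_sym rsym).
  have [||u [w [uA wA]]] :=
    connect_boundary (A := [set x in H | (x == h) || e h x]) hz.
  - by rewrite in_set hH eqxx.
  - by rewrite in_set (negbTE zh) (negbTE nhz) andbF.
  rewrite rE => /and3P[qu qw uw]; move: uA wA; rewrite !in_set.
  case/andP=> uH hu; have wH : w \in H by apply: (stepH u).
  rewrite wH /= negb_or => /andP[wh nhw].
  exists u, w; split=> //.
  by case/predU1P: hu => // uh; move: nhw; rewrite -uh uw.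
have [h''h nhh''] := nh''.
have vh' : e v h'.
  have := @kite_free h h' q h'' v; rewrite (negbTE nvq) orbF; apply=> //.
  - by rewrite esym Hq.
  - by rewrite esym Hq.
  - by rewrite esym.
  - by rewrite esym.
  - by rewrite eq_sym.
  - by rewrite esym.
  - by apply: contraNneq vH => ->.
(* Now [q] and [v] are the tips of a diamond with centre [h], [h'], so every neighbour of [q] sees
   [h] or [h']. *)
have dom x : e q x -> x \in H.
  move=> qx; case: (x =P h) => [->//|/eqP xh]; case: (x =P h') => [->//|/eqP xh'].
  have /orP[] : e x h || e x h'.
  - have qh := Hq _ hH; have qh' := Hq _ h'H.
    apply: (@kite_free q h h' v x); rewrite ?[e x q]esym //.
    + by rewrite esym.
    + by rewrite eq_sym.
    + by rewrite esym.
  - by move=> xh1; apply: (stepH h); rewrite // esym.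
  - by move=> xh1; apply: (stepH h'); rewrite // esym.
move=> Z x y' /subsetP Zq xZ qy' y'Z.
have : connect r x y'.
  have := dom _ (Zq _ xZ); have := dom _ qy'; rewrite !HE => H1 H2.
  by apply: connect_trans H1; rewrite (sym_connect_sym rsym).
case/(connect_boundary)/(_ xZ y'Z) => u [w [uZ wZ]]; rewrite rE => /and3P[_ qw uw].
by exists u, w.
Qed.

(** * Traces of outside vertices on a maximal clique *)

Definition trace (M : {set T}) v := [set m in M | e v m].

Definition maxclique (M : {set T}) :=
  clique e M /\ forall v, v \notin M -> exists2 m, m \in M & ~~ e v m.

Definition shares (M : {set T}) v := (v \notin M) && (1 < #|trace M v|).

Lemma in_trace M v m : (m \in trace M v) = (m \in M) && e v m.
Proof. by rewrite in_set. Qed.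

Lemma maxclique_sup K : clique e K -> exists2 M, maxclique M & K \subset M.
Proof.
case/(maxset_exists (P := clique e)) => M /maxsetP[Mcl Mmax] KM.
exists M => //; split=> // v vM; apply/exists_inP.
apply: contraT; rewrite negb_exists_in => /forall_inP Hv; case/negP: vM.
rewrite -(Mmax (v |: M)) ?setU11 ?subsetUr //.
have {}Hv m : m \in M -> e v m by move/Hv; rewrite negbK.
apply/cliqueP => x y; rewrite !in_setU1.
case/predU1P=> [->|xM]; case/predU1P=> [->|yM] xy; rewrite ?eqxx // in xy *.
- exact: Hv.
- by rewrite esym; exact: Hv.
- exact: (cliqueP _ Mcl).
Qed.

Lemma sharesI (M : {set T}) v b c : v \notin M -> b \in M -> c \in M -> b != c ->
  e v b -> e v c -> shares M v.
Proof.
move=> vM bM cM bc vb vc; rewrite /shares vM; apply/card_gt1P.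
by exists b, c; rewrite !in_trace bM cM vb vc.
Qed.

Lemma sharesP M v : shares M v ->
  v \notin M /\ exists b c, [/\ b \in M, c \in M, b != c, e v b & e v c].
Proof.
case/andP=> vM /card_gt1P[b [c []]]; rewrite !in_trace.
by move=> /andP[bM vb] /andP[cM vc] bc; split=> //; exists b, c.
Qed.

(* [u] and [v] are the two tips of a diamond with centre [b], [c]. *)
Lemma shares_kite (M : {set T}) v u b c x : clique e M -> v \notin M ->
  u \in M -> ~~ e v u -> b \in M -> c \in M -> b != c -> e v b -> e v c ->
  e x u || e x v -> x != b -> x != c -> e x b || e x c.
Proof.
move=> /cliqueP Mcl vM uM nvu bM cM bc vb vc.
have ub : u != b by apply: contraNneq nvu => ->.
have uc : u != c by apply: contraNneq nvu => ->.
have uv : u != v by apply: contraNneq vM => <-.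
have eub := Mcl _ _ uM bM ub; have euc := Mcl _ _ uM cM uc.
have ebc := Mcl _ _ bM cM bc.
case/orP=> xuv xb xc.
  by apply: (@kite_free u b c v x); rewrite // esym.
by apply: (@kite_free v b c u x); rewrite // eq_sym.
Qed.

Section MaximalClique.
Variable M : {set T}.
Hypothesis Mmax : maxclique M.

Let Mcl : {in M &, forall x y, x != y -> e x y}.
Proof. by apply/cliqueP; case: Mmax. Qed.

Let Mout v : v \notin M -> exists2 m, m \in M & ~~ e v m.
Proof. by case: Mmax => _; apply. Qed.

(** By maximality of [M], [v] is a tip of a diamond whose centre lies in [M], and [x] must see that
    centre. *)
Lemma shares_nbr v x : shares M v -> e x v -> x \notin M ->
  exists2 m, m \in M & e x m.
Proof.
case/sharesP=> vM [b [c [bM cM bc vb vc]]] xv xM.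
have [u uM nvu] := Mout vM.
have /orP[] : e x b || e x c; last by exists c.
  apply: (shares_kite (M := M) (v := v) (u := u)); rewrite ?xv ?orbT //.
  - by case: Mmax.
  - by apply: contraNneq xM => ->.
  - by apply: contraNneq xM => ->.
by exists b.
Qed.

(** Otherwise [v] and [m] are the tips of a diamond whose centre lies in [M] and avoids [m]. As a
    neighbour of the tip [m], [x] would see a second vertex of [M]. *)
Lemma private_complete x m v : x \notin M -> trace M x = [set m] ->
  shares M v -> e v m.
Proof.
move=> xM xm /sharesP[vM [b [c [bM cM bc vb vc]]]].
have only y : y \in M -> e x y -> y = m.
  by move=> yM xy; apply/set1P; rewrite -xm in_trace yM.
have /andP[mM xm'] : (m \in M) && e x m by rewrite -in_trace xm set11.
apply: contraT => nvm; have /orP[] : e x b || e x c.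
- apply: (shares_kite (M := M) (v := v) (u := m)); rewrite ?xm' //.
  - by case: Mmax.
  - by apply: contraNneq xM => ->.
  - by apply: contraNneq xM => ->.
- by move/(only _ bM) => bm; rewrite -bm vb in nvm.
- by move/(only _ cM) => cm; rewrite -cm vc in nvm.
Qed.

Hypothesis v0_ex : exists v0, shares M v0.

(** A sharing vertex sees [m] by [private_complete], so [m] is in the centre of a diamond and
    [centre_nbrs_connected] applies. *)
Lemma private_connected x m : x \notin M -> trace M x = [set m] ->
  forall (Z : {set T}) y z, Z \subset e m -> y \in Z -> e m z -> z \notin Z ->
     exists u w, [/\ u \in Z, w \notin Z, e m w & e u w].
Proof.
move=> xM xm; have [v0 v0S] := v0_ex.
have v0m := private_complete xM xm v0S.
have /andP[mM xm'] : (m \in M) && e x m by rewrite -in_trace xm set11.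
have [v0M [b [c [bM cM bc vb vc]]]] := sharesP v0S.
have [m' m'M [mm' vm']] : exists2 m', m' \in M & m != m' /\ e v0 m'.
  by case: (altP (m =P b)) => [->|mb]; [exists c | exists b].
have [u uM nvu] := Mout v0M.
have um : u != m by apply: contraNneq nvu => ->.
have um' : u != m' by apply: contraNneq nvu => ->.
have H := @centre_nbrs_connected m m' v0 u (Mcl mM m'M mm') v0m vm' (Mcl uM mM um)
  (Mcl uM m'M um') (contraNneq (fun E => eq_ind_r (fun z => z \in M) uM E) v0M) nvu.
exact: H.
Qed.

(** Otherwise an edge [x w] leaves the closed neighbourhood [D] of [M]. By [shares_nbr], [x] shares
    nothing, so it has a single neighbour [m] in [M], whose neighbourhood is connected. *)
Lemma maxclique_dominates r : r \notin M -> exists2 m, m \in M & e r m.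
Proof.
move=> rM; apply/exists_inP; apply: contraT => nr.
have [v0 v0S] := v0_ex; have [v0M [b [c [bM cM bc vb vc]]]] := sharesP v0S.
pose D := [set x | (x \in M) || [exists m in M, e x m]].
have [|||||x [w [xD wD _ xw]]] := @no_cut set0 D v0 r.
- by apply/cliqueP => x y; rewrite inE.
- by rewrite disjoint_sym disjoints_subset sub0set.
- by rewrite inE; apply/orP; right; apply/exists_inP; exists b.
- by rewrite inE (negbTE rM) (negbTE nr).
- by rewrite inE.
have wM : w \notin M by apply: contra wD; rewrite inE => ->.
have nw m : m \in M -> ~~ e w m.
  by move=> mM; apply: contra wD => wm; rewrite inE; apply/orP; right;
     apply/exists_inP; exists m.
have noS y : y \notin M -> e y w -> ~~ shares M y.
  move=> yM yw; apply/negP => yS; have [|m mM wm] := shares_nbr yS _ wM.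
    by rewrite esym.
  by rewrite (negbTE (nw m mM)) in wm.
have xM : x \notin M by apply/negP => xM; move: (nw _ xM); rewrite esym xw.
have [m mM xm] : exists2 m, m \in M & e x m.
  by move: xD; rewrite inE (negbTE xM) => /exists_inP.
have trx : trace M x = [set m].
  apply/setP => y; rewrite in_trace inE; apply/andP/eqP=> [[yM xy]|->//].
  apply/eqP; apply: contraT => ym; have := noS x xM xw.
  by rewrite (sharesI (b := m) (c := y)) // eq_sym.
have [m' m'M mm'] : exists2 m', m' \in M & m' != m.
  by case: (altP (m =P b)) => [->|mb]; [exists c | exists b]; rewrite // eq_sym.
(* Inside the neighbourhood of [m], the common neighbours of [m] and [w] and everything adjacent to
   one of these. An edge [u y] leaving [Z] gives a diamond with tips [z], [y] and centre [u], [m];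
   [w] sees the tip [z] but not the centre. *)
pose Z := [set y | e m y && (e y w || [exists z, [&& e m z, e z w & e y z]])].
have ZE y : (y \in Z) = e m y && (e y w || [exists z, [&& e m z, e z w & e y z]]).
  by rewrite inE.
clearbody Z.
have m'Z : m' \notin Z.
  rewrite ZE negb_and negb_or [e m' w]esym nw //=; apply/orP; right.
  apply/existsP => -[z /and3P[mz zw m'z]].
  have zM : z \notin M by apply/negP => zM; move: (nw _ zM); rewrite esym zw.
  have := noS z zM zw; rewrite (sharesI (b := m) (c := m')) // 1?eq_sym //.
  - by rewrite esym.
  - by rewrite esym.
have [||||u [y [uZ yZ my uy]]] :=
  @private_connected x m xM trx Z x m'.
- by apply/subsetP => y; rewrite ZE => /andP[].
- by rewrite ZE esym xm xw.
- by apply: Mcl => //; rewrite eq_sym.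
- exact: m'Z.
have nyw : ~~ e y w by apply: contra yZ => yw; rewrite ZE my yw.
have nyz z : e m z -> e z w -> ~~ e y z.
  move=> mz zw; apply: contra yZ => yz; rewrite ZE my; apply/orP; right.
  by apply/existsP; exists z; rewrite mz zw yz.
move: uZ; rewrite ZE => /andP[mu].
case: (boolP (e u w)) => [uw _|nuw /= /existsP[z /and3P[mz zw uz]]].
  by have := nyz u mu uw; rewrite esym uy.
have nzy : ~~ e z y by rewrite esym; exact: nyz.
have zy : z != y by apply: contraNneq yZ => <-; rewrite ZE mz zw.
have wu : w != u by apply: contraNneq (nw m mM) => ->; rewrite esym.
have wm : w != m by apply: contraNneq wM => ->.
have := @kite_free z u m y w; rewrite [e w u]esym (negbTE nuw) (negbTE (nw m mM)).
by apply; rewrite // esym.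
Qed.
End MaximalClique.

Lemma clique3 a b c : e a b -> e a c -> e b c -> clique e [set a; b; c].
Proof.
move=> ab ac bc; apply/cliqueP => x y; rewrite !inE -!orbA.
by case/or3P=> /eqP->; case/or3P=> /eqP->; rewrite ?eqxx // => _; rewrite // esym.
Qed.

Lemma private_trace M x : maxclique M -> (exists v, shares M v) ->
  x \notin M -> ~~ shares M x -> exists m, trace M x = [set m].
Proof.
move=> Mmax Sex xM xS; have [m mM xm] := maxclique_dominates Mmax Sex xM.
exists m; apply/setP => y; rewrite in_trace inE; apply/andP/eqP=> [[yM xy]|->//].
apply/eqP; apply: contraR xS => ym.
by rewrite (sharesI (b := m) (c := y)) // eq_sym.
Qed.

(** If a maximal clique [M] through a triangle of the diamond fails, there are outside vertices [x],
    [y] whose only neighbours in [M] are distinct vertices [m1], [m2], and a sharing vertex [v]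
    adjacent to both. A maximal clique [M2] through [m1], [m2], [v] then works. *)
Lemma shared_clique_ex a b c d : e b c -> e a b -> e a c -> e d b -> e d c ->
  a != d -> ~~ e a d ->
  exists M, [/\ maxclique M, exists v, shares M v &
                forall x, x \notin M -> shares M x].
Proof.
move=> bc ab ac db dc ad nad.
have [M Mmax sM] := maxclique_sup (clique3 ab ac bc).
have [aM bM cM] : [/\ a \in M, b \in M & c \in M].
  by split; apply: (subsetP sM); rewrite !inE eqxx ?orbT.
have Mcl : {in M &, forall x y, x != y -> e x y} by apply/cliqueP; case: Mmax.
have dM : d \notin M by apply: contra nad => dM; exact: Mcl.
have dS : shares M d by apply: (sharesI (b := b) (c := c)); rewrite ?edge_neq.
have Sex : exists v, shares M v by exists d.
case: (boolP [forall x, (x \notin M) ==> shares M x]) => [/forallP H|].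
  by exists M; split=> // x; apply/implyP.
rewrite negb_forall => /existsP[x0]; rewrite negb_imply => /andP[x0M nS].
have [m1 tr0] := private_trace Mmax Sex x0M nS.
have /andP[m1M x0m1] : (m1 \in M) && e x0 m1 by rewrite -in_trace tr0 set11.
have Sm1 v : shares M v -> e v m1 := private_complete Mmax x0M tr0 (v := v).
have [y ym1 nm1y] := no_universal m1.
have yM : y \notin M.
  by apply: contra nm1y => yM; apply: Mcl; rewrite // eq_sym.
have nyS : ~~ shares M y by apply: contra nm1y => /Sm1; rewrite esym.
have [m2 try] := private_trace Mmax Sex yM nyS.
have /andP[m2M ym2] : (m2 \in M) && e y m2 by rewrite -in_trace try set11.
have Sm2 v : shares M v -> e v m2 := private_complete Mmax yM try (v := v).
have m12 : m1 != m2 by apply: contraNneq nm1y => ->; rewrite esym.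
have em12 := Mcl _ _ m1M m2M m12.
(* An edge leaving the private vertices of [m1] within its neighbourhood ends in a sharing vertex
   [v], for otherwise the trace of [v] would also be just [m1]. *)
pose Z := [set x | (x \notin M) && (trace M x == [set m1])].
have [||||x [v [xZ vZ m1v xv]]] :=
  private_connected Mmax Sex x0M tr0 (Z := Z) (y := x0) (z := m2).
- apply/subsetP => x; rewrite inE => /andP[_ /eqP tr].
  have : m1 \in trace M x by rewrite tr set11.
  by rewrite in_trace esym => /andP[].
- by rewrite inE x0M tr0 eqxx.
- exact: em12.
- by rewrite inE m2M.
move: xZ; rewrite inE => /andP[xM /eqP trx].
have only u : u \in M -> e x u -> u = m1.
  by move=> uM xu; apply/set1P; rewrite -trx in_trace uM.
have xm1 : e x m1 by have := set11 m1; rewrite -trx in_trace => /andP[].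
have nxm2 : ~~ e x m2.
  by apply/negP => /(only _ m2M) E; rewrite E eqxx in m12.
have vM : v \notin M.
  by apply/negP => vM; move: m1v; rewrite (only v vM xv) eirr.
have vS : shares M v.
  apply: contraR vZ => /(private_trace Mmax Sex vM)[n tr].
  have /set1P m1n : m1 \in [set n] by rewrite -tr in_trace m1M esym.
  by rewrite inE vM tr m1n /=.
have vm2 := Sm2 v vS; have vm1 := Sm1 v vS.
have yv : e y v.
  have := @kite_free m2 v m1 x y; rewrite [e y m1]esym (negbTE nm1y) orbF.
  apply=> //; rewrite 1?esym //.
  - by apply: contraNneq xM => <-.
  - by apply: contraNneq nm1y => ->; rewrite esym.
have [M2 M2max sM2] := maxclique_sup (clique3 em12 (m1v) (etrans (esym _ _) vm2)).
have [m1M2 m2M2 vM2] : [/\ m1 \in M2, m2 \in M2 & v \in M2].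
  by split; apply: (subsetP sM2); rewrite !inE eqxx ?orbT.
have M2cl : {in M2 &, forall x y, x != y -> e x y} by apply/cliqueP; case: M2max.
have xM2 : x \notin M2.
  apply: contra nxm2 => xM2; apply: M2cl => //.
  by apply: contraNneq xM => ->.
have yM2 : y \notin M2.
  by apply: contra nm1y => yM2; apply: M2cl; rewrite // eq_sym.
have xS2 : shares M2 x.
  by apply: (sharesI (b := m1) (c := v)); rewrite ?edge_neq.
have yS2 : shares M2 y.
  by apply: (sharesI (b := m2) (c := v)); rewrite ?edge_neq // esym.
have Sex2 : exists v, shares M2 v by exists x.
exists M2; split=> // t tM2; apply: contraT => ntS2.
have [n trt] := private_trace M2max Sex2 tM2 ntS2.
have onlyt u : u \in M2 -> e t u -> u = n.
  by move=> uM2 tu; apply/set1P; rewrite -trt in_trace uM2.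
have xn := private_complete M2max tM2 trt xS2.
have yn := private_complete M2max tM2 trt yS2.
have ntm1 : ~~ e t m1.
  apply/negP => /(onlyt _ m1M2) En; move: nm1y; rewrite En esym.
  by rewrite yn.
have ntm2 : ~~ e t m2.
  by apply/negP => /(onlyt _ m2M2) En; rewrite En xn in nxm2.
have tM : t \notin M.
  apply/negP => tM; case/negP: ntm1; apply: Mcl => //.
  by apply: contraNneq tM2 => ->.
have ntS : ~~ shares M t by apply: contra ntm1 => /Sm1.
have [n' trt'] := private_trace Mmax Sex tM ntS.
have /andP[n'M tn'] : (n' \in M) && e t n' by rewrite -in_trace trt' set11.
have vn' := private_complete Mmax tM trt' vS.
have n'm1 : n' != m1 by apply: contraNneq ntm1 => <-.
have n'm2 : n' != m2 by apply: contraNneq ntm2 => <-.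
have [u uM nvu] : exists2 u, u \in M & ~~ e v u by case: Mmax => _; apply.
(* The centre [m2], [n'] of a diamond with tip [v] lies in [M]; the neighbour [x] of [v] has to see
   it, yet sees only [m1] in [M]. *)
have /orP[] : e x m2 || e x n'.
- apply: (shares_kite (M := M) (v := v) (u := u)); rewrite ?xv ?orbT //.
  + by case: Mmax.
  + by rewrite eq_sym.
  + by apply: contraNneq xM => ->.
  + by apply: contraNneq xM => ->.
- by rewrite (negbTE nxm2).
- by move/(only _ n'M) => E; rewrite E eqxx in n'm1.
Qed.

(** Let [A] be a trace of minimal size. The vertices with trace [A] form a set [C] that is cut off
    from the rest of [M] by the clique consisting of [A] and [W]. *)
Lemma no_shared_clique M : maxclique M -> (exists v, shares M v) ->
  (forall x, x \notin M -> shares M x) -> False.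
Proof.
move=> Mmax [v0 v0S] allS.
have Mcl : {in M &, forall x y, x != y -> e x y} by apply/cliqueP; case: Mmax.
have v0M : v0 \notin M by case/sharesP: v0S.
have traceM x m : m \in trace M x -> m \in M by rewrite in_trace => /andP[].
have traceE x m : m \in trace M x -> e x m by rewrite in_trace => /andP[].
have ntrace x m : m \in M -> m \notin trace M x -> ~~ e x m.
  by move=> mM; rewrite in_trace mM.
have nested v y a b : v \notin M -> y \notin M -> a != b ->
    a \in trace M v -> b \in trace M v -> a \notin trace M y -> b \notin trace M y ->
    trace M y \subset trace M v.
  move=> vM yM ab av bv nay nby; apply/subsetP => c cy; apply: contraT => ncv.
  have /orP[] : e y a || e y b.
  - apply: (shares_kite (M := M) (v := v) (u := c));
      rewrite ?(traceE _ _ cy) ?(traceE _ _ av) ?(traceE _ _ bv)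
              ?(traceM _ _ av) ?(traceM _ _ bv) ?(traceM _ _ cy) //.
    + by case: Mmax.
    + by apply: ntrace => //; exact: traceM cy.
    + by apply: contraNneq yM => ->; exact: traceM av.
    + by apply: contraNneq yM => ->; exact: traceM bv.
  - by rewrite (negbTE (ntrace _ _ (traceM _ _ av) nay)).
  - by rewrite (negbTE (ntrace _ _ (traceM _ _ bv) nby)).
have adj_nested v y a c : v \notin M -> y \notin M -> e v y ->
    a \in trace M v -> c \in trace M y -> a \notin trace M y -> c \in trace M v.
  move=> vM yM vy av cy nay; apply: contraT => ncv.
  have ac : a != c by apply: contraNneq ncv => <-.
  have ya : e y a.
    rewrite esym; apply: (@C4_free v a c y); rewrite ?[e y v]esym //.
    + exact: traceE.
    + by apply: Mcl => //; [exact: traceM av | exact: traceM cy].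
    + by rewrite esym; exact: traceE.
    + by apply: ntrace => //; exact: traceM cy.
    + by apply: contraNneq vM => ->; exact: traceM cy.
    + by apply: contraNneq yM => <-; exact: traceM av.
  by rewrite (negbTE (ntrace _ _ (traceM _ _ av) nay)) in ya.
have adj_one v y a b : v \notin M -> y \notin M -> e v y ->
    a \in trace M v -> b \in trace M v -> a \notin trace M y -> b \notin trace M y ->
    a = b.
  move=> vM yM vy av bv nay nby; apply/eqP; apply: contraT => ab.
  have [u uM nvu] : exists2 u, u \in M & ~~ e v u by case: Mmax => _; apply.
  have /orP[] : e y a || e y b.
  - apply: (shares_kite (M := M) (v := v) (u := u));
      rewrite ?(traceE _ _ av) ?(traceE _ _ bv) ?[e y v]esym ?vy ?orbT
              ?(traceM _ _ av) ?(traceM _ _ bv) //.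
    + by case: Mmax.
    + by apply: contraNneq yM => ->; exact: traceM av.
    + by apply: contraNneq yM => ->; exact: traceM bv.
  - by rewrite (negbTE (ntrace _ _ (traceM _ _ av) nay)).
  - by rewrite (negbTE (ntrace _ _ (traceM _ _ bv) nby)).
(* From here on [A] has minimal size, [a] lies in [A], and [y] misses [a]. By [nested], the trace of
   [y] is [A] with [a] exchanged for one vertex [z]. *)
case: (arg_minnP (P := [pred x | x \notin M]) (fun x => #|trace M x|) v0M).
move=> v /= vM vmin; set A := trace M v.
have [a [_ [aA _ _]]] := card_gt1P (proj2 (andP (allS v vM))).
have aM := traceM _ _ aA.
have [y ya nay] := no_universal a.
have yM : y \notin M.
  by apply: contra nay => yM; apply: Mcl; rewrite // eq_sym.
have nya : a \notin trace M y by rewrite in_trace negb_and esym nay orbT.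
have minimal x : x \notin M -> trace M x \subset A -> trace M x = A.
  by move=> xM sx; apply/eqP; rewrite eqEcard sx vmin.
have [z zy nzA] : exists2 z, z \in trace M y & z \notin A.
  apply/subsetPn; apply: contra nya => /(minimal y yM) ->; exact: aA.
have zM := traceM _ _ zy.
have Ay b : b \in A -> b != a -> b \in trace M y.
  move=> bA ba; apply: contraR nzA => nby.
  exact: (subsetP (nested v y b a vM yM ba bA aA nby nya)).
have onlyz c : c \in trace M y -> c \notin A -> c = z.
  move=> cy ncA; apply/eqP; apply: contraR nya => cz.
  exact: (subsetP (nested y v c z yM vM cz cy zy ncA nzA)).
pose C := [set x in ~: M | trace M x == A].
pose W := [set w in ~: M | (trace M w == z |: A) && e w y].
have CP x : x \in C -> x \notin M /\ trace M x = A.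
  by rewrite in_set in_setC => /andP[-> /eqP].
have WP w : w \in W -> [/\ w \notin M, trace M w = z |: A & e w y].
  by rewrite in_set in_setC => /and3P[-> /eqP].
have [|||||x [w [xC wC wK xw]]] := @no_cut (A :|: W) C v z.
(* Two vertices of [W] are common neighbours of the non-adjacent [y] and [a], so they are adjacent
   by [C4]-freeness. *)
- apply/cliqueP => p q; rewrite !in_setU.
  have AW p' w' : p' \in A -> w' \in W -> e w' p'.
    by move=> pA /WP[_ tr _]; apply: traceE; rewrite tr in_setU1 pA orbT.
  case/orP=> [pA|pW]; case/orP=> [qA|qW] pq.
  + by apply: Mcl => //; [exact: traceM pA | exact: traceM qA].
  + by rewrite esym; exact: AW.
  + exact: AW.
  + have [_ _ py] := WP _ pW; have [_ _ qy] := WP _ qW.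
    have := @C4_free y p a q; rewrite [e y p]esym [e a q]esym [e y a]esym.
    by apply=> //; exact: AW.
- rewrite disjoints_subset; apply/subsetP => x /CP[xM trx].
  rewrite in_setC in_setU negb_or; apply/andP; split.
    by apply: contra xM; exact: traceM.
  apply: contra nzA => /WP[_ tr _]; rewrite -trx tr; exact: setU11.
- by rewrite !inE vM eqxx.
- by rewrite !inE zM.
- by rewrite in_setU (negbTE nzA) /=; apply/negP => /WP[]; rewrite zM.
have [xM trx] := CP _ xC.
have wM : w \notin M.
  apply: contra wK => wM; rewrite in_setU; apply/orP; left.
  by rewrite -trx in_trace wM.
have trwA : trace M w != A by apply: contra wC => tr; rewrite !inE wM.
have [t tw ntA] : exists2 t, t \in trace M w & t \notin A.
  by apply/subsetPn; apply: contra trwA => /(minimal w wM) ->.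
have Aw b : b \in A -> b \in trace M w.
  move=> bA; apply: contraR ntA => nbw; rewrite -trx.
  by apply: (adj_nested x w b t) => //; rewrite trx.
have onlyt c : c \in trace M w -> c \notin A -> c = t.
  by move=> cw ncA; apply: (adj_one w x); rewrite ?trx // esym.
have at_ : a != t by apply: contraNneq ntA => <-.
(* If [y] missed both [a] and [t], its trace would be contained in that of [w], making [z] the only
   vertex added to [A]. *)
have tz : t = z.
  have [ty|nty] := boolP (t \in trace M y); first exact: onlyz.
  symmetry; apply: onlyt => //.
  exact: (subsetP (nested w y a t wM yM at_ (Aw a aA) tw nya nty)).
have trw : trace M w = z |: A.
  apply/setP => c; rewrite in_setU1; apply/idP/predU1P => [cw|[->|]]; last exact: Aw.
    by case: (boolP (c \in A)) => [|ncA]; [right | left; rewrite -tz; exact: onlyt].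
  by rewrite -tz.
case/negP: wK; rewrite in_setU; apply/orP; right.
rewrite in_set in_setC wM trw eqxx /= esym.
have zw : e z w by rewrite esym; apply: traceE; rewrite trw setU11.
have wa : e w a by apply: traceE; exact: Aw.
have za : e z a by apply: Mcl => //; apply: contraNneq nzA => ->.
have xa : e x a by apply: traceE; rewrite trx.
have zx : z != x by apply: contraNneq xM => <-.
have nzx : ~~ e z x by rewrite esym; apply: ntrace; rewrite // trx.
have yw : y != w by apply: contraNneq nya => ->; exact: Aw.
(* The diamond with tips [z], [x] and centre [w], [a]: since [y] sees [z] but not [a], it sees [w],
   which puts [w] in [W]. *)
have := @kite_free z w a x y wa zw za xw xa zx nzx (traceE _ _ zy) yw ya.
by rewrite [e y a]esym (negbTE nay) orbF.
Qed.

Lemma diamond_free_of_no_universal a b c d :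
  e b c -> e a b -> e a c -> e d b -> e d c -> a != d -> e a d.
Proof.
move=> bc ab ac db dc ad; apply: contraT => nad.
have [M [Mmax Sex allS]] := shared_clique_ex bc ab ac db dc ad nad.
by case: (no_shared_clique Mmax Sex allS).
Qed.
End Diamond.

(** * Removing the universal vertices *)

Lemma Hfree_code (T : finType) (e : rel T) n (E : seq (nat * nat)) (x0 : T) s :
  symmetric e -> irreflexive e -> Hfree e (@erel n E) ->
  irreflexive (edges E) -> size s = n -> uniq s ->
  code e s = code (edges E) (iota 0 n) -> False.
Proof.
move=> esym eirr hfree hirr sn Us Hc.
have hsym : symmetric (edges E) by move=> i j; rewrite /edges orbC.
apply: hfree; exists (fun i : 'I_n => nth x0 s i); split=> i j.
  by move/eqP; rewrite nth_uniq ?sn // => /eqP/val_inj.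
rewrite (code_eq x0 0 esym eirr hsym hirr Hc) ?sn //.
by rewrite !nth_iota.
Qed.

Section LocalRules.
Variables (T : finType) (e : rel T).
Hypotheses (esym : symmetric e) (eirr : irreflexive e).
Hypotheses (hC4 : Hfree e C4) (hkite : Hfree e kite).

Lemma C4_rule a b c d :
  e a b -> e b c -> e c d -> e d a -> ~~ e a c -> a != c -> b != d -> e b d.
Proof.
move=> ab bc cd da nac ac bd; apply: contraT => nbd; exfalso.
have neq := edge_neq eirr.
apply: (Hfree_code a esym eirr hC4 (s := [:: a; b; c; d])) => //.
- by move=> i; rewrite /edges orbb !inE !xpair_eqE; case: i => [|[|[|[]]]].
- by rewrite /= !inE !negb_or ac bd !neq // esym.
- by rewrite /= ab bc cd [e a d]esym da (negbTE nac) (negbTE nbd).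
Qed.

Lemma kite_rule a b c d x :
  e b c -> e a b -> e a c -> e d b -> e d c -> a != d -> ~~ e a d ->
  e x a -> x != b -> x != c -> e x b || e x c.
Proof.
move=> bc ab ac db dc ad nad xa xb xc; apply: contraT; rewrite negb_or.
case/andP=> nxb nxc; exfalso; have neq := edge_neq eirr.
(* If [x] saw both tips, the cycle [x a b d] would need a chord; hence the five vertices induce a
   kite. *)
have nxd : ~~ e x d.
  apply: contra nad => xd; apply: (@C4_rule x a b d) => //; by rewrite esym.
have xd : x != d by apply: contraNneq nad => <-; rewrite esym.
apply: (Hfree_code a esym eirr hkite (s := [:: a; b; c; d; x])) => //.
- by move=> i; rewrite /edges orbb !inE !xpair_eqE; case: i => [|[|[|[|[]]]]].
- rewrite /= !inE !negb_or ad [b == x]eq_sym [c == x]eq_sym [d == x]eq_sym.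
  by rewrite xb xc xd !neq // esym.
- rewrite /= ab ac bc [e b d]esym [e c d]esym db dc [e a x]esym xa.
  rewrite [e b x]esym [e c x]esym [e d x]esym.
  by rewrite (negbTE nad) (negbTE nxb) (negbTE nxc) (negbTE nxd).
Qed.
End LocalRules.

(** If no edge left [C], the roots of [x] and [y] would lie in distinct components of the graph
    without [K], whereas the whole graph has at most one. *)
Lemma no_cut_rule (T : finType) (e : rel T) (K C : {set T}) x y :
  symmetric e -> connected e -> ~ clique_cutset e K -> clique e K ->
  [disjoint C & K] -> x \in C -> y \notin C -> y \notin K ->
  exists u w, [/\ u \in C, w \notin C, w \notin K & e u w].
Proof.
move=> esym [_ Hconn] Hcut Kcl CK xC yC yK.
case: (boolP [exists u, exists w, [&& u \in C, w \notin C, w \notin K & e u w]]).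
  by case/existsP=> u /existsP[w /and4P[]]; exists u, w.
rewrite negb_exists => /forallP Hno; case: Hcut; split=> //.
have rsym S : symmetric (restr e S).
  by move=> u w; rewrite /restr [e u w]esym andbCA.
have csym S := sym_connect_sym (rsym S).
have eT : restr e setT =2 e by move=> u w; rewrite /restr !inE.
apply: (@leq_ltn_trans 1).
  rewrite /ncomp /n_comp_mem; apply/card_le1_eqP => u w.
  rewrite !inE => /andP[/eqP uR _] /andP[/eqP wR _]; rewrite -uR -wR.
  by apply/(rootP (csym _)); rewrite (eq_connect eT).
have xK : x \notin K by rewrite (disjointFr CK).
have stay (A : {set T}) z : z \in A ->
    (forall u w, u \in A -> w \notin A -> ~~ restr e (~: K) u w) ->
    root (restr e (~: K)) z \in A.
  move=> zA HA; apply: contraT => rA.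
  have [u [w [uA wA]]] := connect_boundary (connect_root _ z) zA rA.
  by rewrite (negbTE (HA u w uA wA)).
have HC u w : u \in C -> w \notin C -> ~~ restr e (~: K) u w.
  move=> uC wC; apply/negP; rewrite /restr !inE => /and3P[_ wK uw].
  by have := Hno u; rewrite negb_exists => /forallP/(_ w); rewrite uC wC wK uw.
have HK u w : u \in ~: K -> w \notin ~: K -> ~~ restr e (~: K) u w.
  by move=> _ wK; rewrite /restr (negbTE wK) andbF.
have rx : root (restr e (~: K)) x \in C by exact: stay.
have ry : root (restr e (~: K)) y \in ~: C.
  apply: stay; rewrite ?inE // => u w uC wC; rewrite rsym; apply: HC.
    by move: wC; rewrite inE negbK.
  by move: uC; rewrite inE.
rewrite /ncomp /n_comp_mem; apply/card_gt1P.
exists (root (restr e (~: K)) x), (root (restr e (~: K)) y).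
rewrite !inE !roots_root // ; split.
- by have := stay (~: K) x; rewrite !inE; apply.
- by have := stay (~: K) y; rewrite !inE; apply.
by apply: contraTneq rx => ->; move: ry; rewrite inE.
Qed.

Section DropUniversal.
Variables (T : finType) (e : rel T).
Hypotheses (esym : symmetric e) (eirr : irreflexive e) (Gconn : connected e).
Hypotheses (hP7 : Hfree e P7) (hC4 : Hfree e C4) (hkite : Hfree e kite).
Hypothesis hdeg : forall x : T, omega e + 1 <= deg e x.
Hypothesis hnocut : forall K : {set T}, ~ clique_cutset e K.

Definition universal : {set T} := [set x | [forall y, (y != x) ==> e x y]].

Definition core := {x : T | x \notin universal}.
Definition core_rel : rel core := relpre val e.

Lemma universal_adj x y : x \in universal -> y != x -> e x y.
Proof. by rewrite inE => /forallP/(_ y)/implyP. Qed.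

Lemma clique_le_omega (K : {set T}) : clique e K -> #|K| <= omega e.
Proof. exact: (leq_bigmax_cond (F := fun A : {set T} => #|A|)). Qed.

Lemma core_Hfree (U : finType) (h : rel U) : Hfree e h -> Hfree core_rel h.
Proof.
move=> He [f [finj fe]]; apply: He; exists (val \o f); split=> //.
exact: (inj_comp val_inj).
Qed.

Lemma core_lift_clique (K : {set core}) :
  clique core_rel K -> clique e (val @: K :|: universal).
Proof.
move/cliqueP=> Kcl; apply/cliqueP => x y; rewrite !in_setU.
case/orP=> [/imsetP[x' x'K ->]|xU]; case/orP=> [/imsetP[y' y'K ->]|yU] xy.
- by apply: Kcl => //; apply: contra xy => /eqP->.
- by rewrite esym; exact: universal_adj.
- by apply: universal_adj; rewrite // eq_sym.
- by apply: universal_adj; rewrite // eq_sym.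
Qed.

(** Adding all universal vertices to [K] gives a clique of the whole graph, and an edge avoiding it
    ends in the core. *)
Lemma core_no_cut (K C : {set core}) x y : clique core_rel K ->
  [disjoint C & K] -> x \in C -> y \notin C -> y \notin K ->
  exists u w, [/\ u \in C, w \notin C, w \notin K & core_rel u w].
Proof.
move=> Kcl CK xC yC yK.
have imE (A : {set core}) (z : core) : (val z \in val @: A) = (z \in A).
  exact: (mem_imset _ _ val_inj).
have [||||u [w [/imsetP[u' u'C ->] wC wK uw]]] :=
  no_cut_rule (C := val @: C) (x := val x) (y := val y) esym Gconn
    (@hnocut _) (core_lift_clique Kcl).
- rewrite disjoints_subset; apply/subsetP => _ /imsetP[z zC ->].
  by rewrite in_setC in_setU imE negb_or (disjointFr CK zC) (valP z).
- by rewrite imE.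
- by rewrite imE.
- by rewrite in_setU imE negb_or yK (valP y).
move: wK; rewrite in_setU negb_or => /andP[wK wU].
exists u', (exist _ w wU); split=> //.
- by rewrite -imE.
- by rewrite -imE.
Qed.

Lemma core_no_universal (x : core) : exists2 y, y != x & ~~ core_rel x y.
Proof.
have := valP x; rewrite inE negb_forall => /existsP[y].
rewrite negb_imply => /andP[yx nxy].
have yU : y \notin universal.
  by apply: contra nxy => yU; rewrite esym universal_adj // eq_sym.
by exists (exist _ y yU).
Qed.

(** With [x] and the universal vertices, [Q] is a clique of size at most [omega e], while [x] has
    degree at least [omega e + 1]. Cancelling the universal vertices leaves two neighbours outside
    [Q]. *)
Lemma core_spread (x : core) (Q : {set core}) :
  clique core_rel Q -> Q \subset core_rel x ->
  1 < #|[set y | core_rel x y] :\: Q|.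
Proof.
move=> Qcl Qx; set N := [set y | _].
have QN : Q \subset N by apply/subsetP => y yQ; rewrite in_set; exact: (subsetP Qx).
have xQ : x \notin Q.
  by apply/negP => /(subsetP Qx); rewrite unfold_in /core_rel /= eirr.
have xQcl : clique core_rel (x |: Q).
  apply/cliqueP => y z; rewrite !in_setU1.
  case/predU1P=> [->|yQ]; case/predU1P=> [->|zQ] yz; rewrite ?eqxx // in yz *.
  - exact: (subsetP Qx).
  - by rewrite /core_rel /= esym; exact: (subsetP Qx).
  - exact: (cliqueP _ _ Qcl).
have cardU (A : {set core}) : #|val @: A :|: universal| = #|A| + #|universal|.
  rewrite cardsU card_imset; last exact: val_inj.
  rewrite (_ : _ :&: _ = set0) ?cards0 ?subn0 //.
  apply/setP => z; rewrite !inE; apply/andP => -[/imsetP[z' _ ->]] zU.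
  by have := valP z'; rewrite inE zU.
have le_omega : #|Q| + 1 + #|universal| <= omega e.
  have := clique_le_omega (core_lift_clique xQcl).
  by rewrite cardU cardsU1 xQ [1 + _]addnC.
have : deg e (val x) <= #|N| + #|universal|.
  rewrite -cardU; apply: subset_leq_card; apply/subsetP => y; rewrite inE => xy.
  rewrite in_setU; case: (boolP (y \in universal)) => [_|yU]; first by rewrite orbT.
  by rewrite orbF; apply/imsetP; exists (exist _ y yU); rewrite // inE.
move/(leq_trans (hdeg _)) => H.
rewrite cardsD (setIidPr QN) ltn_subRL -(ltn_add2r #|universal|).
by apply: leq_trans H; rewrite [omega e + 1]addn1 ltnS.
Qed.

(** A complete graph would have at most [omega e] vertices, fewer than the degree of any vertex. *)
Lemma core_inhabited : exists x : T, x \notin universal.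
Proof.
have [[x _] _] := Gconn; apply/existsP; apply: contraT.
rewrite negb_exists => /forallP Hall.
have Tcl : clique e setT.
  apply/cliqueP => y z _ _ yz; rewrite esym universal_adj //.
  by have := Hall z; rewrite negbK.
have := clique_le_omega Tcl.
rewrite cardsT => /(leq_trans (max_card [set y | e x y]))/(leq_trans (hdeg x)).
by rewrite addn1 ltnn.
Qed.

Lemma core_petersen : isomorphic core_rel petersen.
Proof.
have [x xU] := core_inhabited.
have core_sym : symmetric core_rel by move=> y z; exact: esym.
have core_irr : irreflexive core_rel by move=> y; exact: eirr.
apply: (isomorphic_petersen core_sym core_irr) (exist _ x xU).
- exact: core_Hfree.
- exact: core_Hfree.
- apply: (diamond_free_of_no_universal core_sym core_irr).
  + by move=> a b c d; exact: (C4_rule esym eirr hC4).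
  + by move=> a b c d y; exact: (kite_rule esym eirr hC4 hkite).
  + exact: core_no_cut.
  + exact: core_no_universal.
- exact: core_spread.
move=> A y z yA zA; have [|||||u [w [uA wA _ uw]]] := @core_no_cut set0 A y z.
- by apply/cliqueP => a b; rewrite inE.
- by rewrite disjoint_sym disjoints_subset sub0set.
- exact: yA.
- exact: zA.
- by rewrite inE.
by exists u, w.
Qed.

Lemma isomorphic_join (U : finType) (h : rel U) : isomorphic core_rel h ->
  isomorphic e (join_rel #|{: {x | x \in universal}}| h).
Proof.
case=> f [[g fK gK] fh]; set l := #|_|.
pose G (s : 'I_l + U) : T :=
  match s with inl i => val (enum_val i) | inr u => val (g u) end.
pose F (x : T) : 'I_l + U :=
  match boolP (x \in universal) with
  | AltTrue xU => inl (enum_rank (exist _ x xU : {x | x \in universal}))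
  | AltFalse xU => inr (f (exist _ x xU))
  end.
have FK : cancel F G.
  move=> x; rewrite /F; case: {-}_ / boolP => xU /=.
    by rewrite enum_rankK.
  by rewrite fK.
have GU i : G (inl i) \in universal by exact: valP (enum_val i).
have Gneq i w : G (inr w) != G (inl i).
  by apply/eqP => E; have := valP (g w); rewrite -[val _]/(G (inr w)) E GU.
(* [FK] already inverts on one side, so injectivity of [G] is enough. *)
have GK : cancel G F.
  have injG : injective G.
    move=> [i|u] [j|w] /= H.
    - by congr inl; apply: enum_val_inj; apply: val_inj.
    - by have := Gneq i w; rewrite /= H eqxx.
    - by have := Gneq j u; rewrite /= H eqxx.
    - by congr inr; apply: (can_inj gK); apply: val_inj.
  by move=> s; apply: injG; rewrite FK.
exists F; split; first by exists G.
move=> x y; rewrite -{2}(FK x) -{2}(FK y).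
case: (F x) => [i|u]; case: (F y) => [j|w] /=.
- case: (altP (i =P j)) => [->|ij]; first by rewrite eirr.
  rewrite universal_adj ?(GU i) // eq_sym.
  by apply: contra ij => /eqP/val_inj/enum_val_inj->.
- by rewrite (universal_adj (GU i) (Gneq i w)).
- by rewrite esym (universal_adj (GU j) (Gneq j u)).
- by rewrite -[h u w]/(h u w) -{1}(gK u) -{1}(gK w) fh.
Qed.
End DropUniversal.

Theorem theorem1p2 (T : finType) (e : rel T)
  (esym : symmetric e) (eirr : irreflexive e)
  (Gconn : connected e)
  (hP7 : Hfree e P7) (hC4 : Hfree e C4) (hkite : Hfree e kite)
  (hdeg : forall x : T, omega e + 1 <= deg e x)
  (hnocut : forall K : {set T}, ~ clique_cutset e K) :
  exists l : nat,
    isomorphic e (join_rel l petersen) \/ isomorphic e (join_rel l Fgraph).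
Proof.
exists #|{: {x | x \in universal e}}|; left; apply: isomorphic_join => //.
exact: core_petersen.
Qed.
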